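(* Let $\boldsymbol{P}\in\mathbb{R}^{J^D\times J^D}$ be a permutation matrix that consists of $R$ (disjoint) permutation cycles $C_1,\ldots,C_R$, and let $|C_r|$ denote the number of tensor entries in $C_r$. Define $\boldsymbol{V}\in\mathbb{R}^{J^D\times R}$ by $$v_{\overline{j_1 j_2\ldots j_D},\,r}=\begin{cases}\dfrac{1}{\sqrt{|C_r|}} & \text{if the entry with index } (j_1,\ldots,j_D) \text{ belongs to } C_r,\\[1ex] 0 & \text{otherwise.}\end{cases}$$ Then the range of $\boldsymbol{V}$ is the eigenspace $\{\boldsymbol{w}\in\mathbb{R}^{J^D}:\boldsymbol{P}\boldsymbol{w}=\boldsymbol{w}\}$ of $\boldsymbol{P}$ corresponding to the eigenvalue $\lambda=1$. Moreover $\boldsymbol{V}=\sqrt{\boldsymbol{P}_0}$, i.e. $\boldsymbol{V}\boldsymbol{V}^T=\boldsymbol{P}_0$, where $\boldsymbol{P}_0=\frac{1}{K}\sum_{k=1}^{K}\boldsymbol{P}^k$ and $K$ is the order of $\boldsymbol{P}$. Also, $\boldsymbol{V}^T\boldsymbol{V}=\boldsymbol{I}_R$.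
   Context: The permutation matrix $\boldsymbol{P}$ acts on vectorized tensors $\boldsymbol{w}=\mathrm{vec}(\mathcal{W})$, $\mathcal{W}\in\mathbb{R}^{J\times\cdots\times J}$ ($D$ modes), so it permutes the $J^D$ tensor entries; its cycles (including cycles of length 1, i.e. fixed points) partition the set of all tensor entries. The merged index is $\overline{j_1j_2\ldots j_D}=j_1+(j_2-1)J+\cdots+(j_D-1)J^{D-1}$. The order $K$ of $\boldsymbol{P}$ is the smallest positive integer with $\boldsymbol{P}^K=\boldsymbol{I}$. A square root $\sqrt{\boldsymbol{P}_0}$ of $\boldsymbol{P}_0$ is by definition a real matrix with $\boldsymbol{P}_0=\sqrt{\boldsymbol{P}_0}\,(\sqrt{\boldsymbol{P}_0})^T$; it is not unique. *)

(* Defs.v *)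
From HB Require Import structures.
From mathcomp Require Import all_boot all_order all_algebra all_fingroup.
From mathcomp Require Import classical_sets reals.

Set Implicit Arguments.
Unset Strict Implicit.
Unset Printing Implicit Defensive.

Import Order.TTheory GRing.Theory Num.Theory.

(* The positions (j_1, ..., j_D) of the entries of a D-mode J x ... x J tensor,
   numbered from 0. *)
Definition tindex (J D : nat) := {ffun 'I_D -> 'I_J}.

(* With j_1, ..., j_D and the merged index all shifted to start at 0, the merged
   index j_1 + (j_2 - 1) J + ... + (j_D - 1) J^(D-1) becomes the sum below. *)
Definition merge_nat (J D : nat) (j : 'I_D -> 'I_J) : nat :=
  \sum_(d < D) j d * J ^ d.

Lemma merge_nat_lt (J D : nat) (j : 'I_D -> 'I_J) : merge_nat j < J ^ D.
Proof.
rewrite /merge_nat; elim: D j => [|D IH] j; first by rewrite big_ord0 expn0.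
rewrite big_ord_recr /=.
have lt1 := IH (fun d => j (widen_ord (leqnSn D) d)).
apply: (@leq_trans ((j ord_max).+1 * J ^ D)).
  by rewrite mulSn -addSn leq_add2r.
by rewrite expnS leq_mul2r ltn_ord orbT.
Qed.

Definition merge (J D : nat) (j : tindex J D) : 'I_(J ^ D) :=
  Ordinal (merge_nat_lt j).

Lemma merge_nat_inj (J D : nat) (j k : 'I_D -> 'I_J) :
  merge_nat j = merge_nat k -> j =1 k.
Proof.
rewrite /merge_nat; elim: D j k => [|D IH] j k; first by move=> _ [].
rewrite !big_ord_recr /=.
have lt1 := merge_nat_lt (fun d => j (widen_ord (leqnSn D) d)).
have lt2 := merge_nat_lt (fun d => k (widen_ord (leqnSn D) d)).
rewrite /merge_nat in lt1 lt2 => E.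
have JD0 : 0 < J ^ D by apply: leq_ltn_trans lt1.
have Et : j ord_max = k ord_max.
  apply: val_inj => /=; move/(congr1 (divn^~ (J ^ D))): E.
  by rewrite !(addnC (\sum_(_ < _) _)) !divnMDl // !divn_small // !addn0.
move/eqP: E; rewrite Et eqn_add2r => /eqP/(IH _ _) E d.
case: (unliftP ord_max d) => [d'|] -> //.
by have -> : lift ord_max d' = widen_ord (leqnSn D) d'
  by [apply: val_inj; rewrite /= /bump leqNgt ltn_ord]; apply: E.
Qed.

Lemma merge_bij (J D : nat) : bijective (@merge J D).
Proof.
apply: inj_card_bij; last by rewrite card_ffun !card_ord.
by move=> j k /(congr1 val) /= /merge_nat_inj E; apply/ffunP.
Qed.

Local Open Scope ring_scope.

Definition is_mx_order (R : realType) (n : nat) (P : 'M[R]_n) (K : nat) : Prop :=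
  [/\ (0 < K)%N, P ^+ K = 1%:M
    & forall m : nat, (0 < m)%N -> P ^+ m = 1%:M -> (K <= m)%N].

Definition mx_average (R : realType) (n : nat) (P : 'M[R]_n) (K : nat) : 'M[R]_n :=
  K%:R^-1 *: \sum_(1 <= k < K.+1) P ^+ k.

(* The root need not be a square matrix, and is not unique. *)
Definition is_sqrt_mx (R : realType) (n r : nat)
    (S : 'M[R]_(n, r)) (A : 'M[R]_n) : Prop :=
  A = S *m S^T.

(* C lists, without repetition, the cycles of s as sets of tensor entries.
   [porbits s] contains the singleton orbits of the fixed points. *)
Definition lists_cycles (J D r : nat) (s : 'S_(J ^ D))
    (C : 'I_r -> {set tindex J D}) : Prop :=
  injective C /\ [set (@merge J D) @: C c | c : 'I_r]%SET = porbits s.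

Definition mx_range (R : realType) (n r : nat) (V : 'M[R]_(n, r)) : set 'cV[R]_n :=
  [set w | exists x : 'cV[R]_r, w = V *m x]%classic.

(* Entries are given at merged indices, which exhaust the rows by [merge_bij]. *)
Definition is_cycle_mx (R : realType) (J D r : nat)
    (C : 'I_r -> {set tindex J D}) (V : 'M[R]_(J ^ D, r)) : Prop :=
  forall (j : tindex J D) (c : 'I_r),
    V (merge j) c = if j \in C c then 1 / Num.sqrt (#|C c|%:R) else 0.

(* Main.v *)
(** Fix [W] with [P *m W = W]. It is constant along the orbits of the permutation,
    so averaging over each orbit changes nothing: [V *m V^T *m W = W]. The average
    [Q] of the powers of [P] satisfies [Q *m P = Q], hence [P *m Q^T = Q^T], so
    this applies to [Q^T]; on the other hand [P *m V = V] gives [Q *m V = V]. Transposing the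
    latter, [Q^T = V *m V^T *m Q^T = V *m V^T], which is symmetric. *)
Require Import Defs.
From HB Require Import structures.
From mathcomp Require Import all_boot all_order all_algebra all_fingroup.
From mathcomp Require Import classical_sets reals.

Set Implicit Arguments.
Unset Strict Implicit.
Unset Printing Implicit Defensive.

Import Order.TTheory GRing.Theory Num.Theory.
Local Open Scope ring_scope.

Section Average.

Variables (R : realType) (n K : nat) (P : 'M[R]_n).
Hypotheses (K_gt0 : (0 < K)%N) (PK : P ^+ K = 1%:M).

(** Since [P ^+ K] and [P ^+ 0] are both the identity, the last term can be traded for a term of
    exponent 0. *)
Lemma sum_powers_shift : \sum_(1 <= k < K.+1) P ^+ k = \sum_(0 <= k < K) P ^+ k.
Proof.
by rewrite big_nat_recr //= PK [RHS]big_ltn // expr0 addrC.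
Qed.

Lemma average_mulmx : mx_average P K *m P = mx_average P K.
Proof.
(* Only the left sum is shifted: multiplying by [P] then raises its exponents from 0..K-1 to
   1..K. *)
rewrite /mx_average -scalemxAl {1}sum_powers_shift; congr (_ *: _).
rewrite big_add1 mulmx_suml; apply: eq_bigr => k _.
by rewrite exprSr.
Qed.

Lemma average_fixed m (W : 'M[R]_(n, m)) : P *m W = W -> mx_average P K *m W = W.
Proof.
move=> PW; rewrite /mx_average -scalemxAl mulmx_suml.
under eq_bigr => k _.
  have -> : P ^+ k *m W = W.
    by elim: k => [|k IHk]; rewrite ?expr0 ?mul1mx // exprS -mulmxA IHk.
  over.
rewrite sumr_const_nat subSS subn0 -scaler_nat scalerA mulVf ?scale1r //.
by rewrite pnatr_eq0 -lt0n.
Qed.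

End Average.

Section OrbitMatrix.

Variables (R : realType) (n r : nat) (s : 'S_n) (A : 'I_r -> {set 'I_n}).
Hypotheses (A_inj : injective A) (A_porbits : [set A c | c : 'I_r]%SET = porbits s).
Variable V : 'M[R]_(n, r).
Hypothesis VE : forall i c,
  V i c = if i \in A c then 1 / Num.sqrt (#|A c|%:R) else 0.

(** Each block is an orbit, and orbits that meet coincide. With [A_inj], this makes blocks with
    distinct indices disjoint. *)
Lemma mem_orbit_block i c : (i \in A c) = (A c == porbit s i).
Proof.
have: A c \in porbits s by rewrite -A_porbits imset_f.
by case/imsetP=> j _ ->; rewrite eq_porbit_mem porbit_sym.
Qed.

Lemma orbit_blockP i : exists c, A c = porbit s i.
Proof.
have: porbit s i \in porbits s by rewrite imset_f.
by rewrite -A_porbits => /imsetP[c _ ->]; exists c.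
Qed.

Lemma orbit_block_gt0 c : 0 < #|A c|%:R :> R.
Proof.
have: A c \in porbits s by rewrite -A_porbits imset_f.
case/imsetP=> j _ ->; rewrite ltr0n; apply/card_gt0P; exists j.
exact: porbit_id.
Qed.

Lemma orbit_weight_sqr c :
  (1 / Num.sqrt (#|A c|%:R)) * (1 / Num.sqrt (#|A c|%:R)) = #|A c|%:R^-1 :> R.
Proof.
by rewrite !mul1r -invfM -expr2 sqr_sqrtr // ltW // orbit_block_gt0.
Qed.

(** Distinct columns have disjoint supports, and column [c] has [#|A c|] nonzero entries, each of
    square [#|A c|%:R^-1]. *)
Lemma orbit_mx_orthonormal : V^T *m V = 1%:M.
Proof.
apply/matrixP=> c d; rewrite !mxE.
under eq_bigr do rewrite mxE !VE.
have [<-|cd] /= := eqVneq c d.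
  under eq_bigr => i _.
    rewrite (_ : _ * _ = if i \in A c then #|A c|%:R^-1 else 0); first over.
    by case: ifP => _; rewrite ?mulr0 ?orbit_weight_sqr.
  rewrite -big_mkcond /= sumr_const -[LHS]mulr_natl mulfV //.
  by rewrite gt_eqF // orbit_block_gt0.
rewrite big1 // => i _; case: ifP => [ic|]; last by rewrite mul0r.
case: ifP => [id|]; last by rewrite mulr0.
move: ic id cd; rewrite !mem_orbit_block => /eqP <- /eqP /A_inj ->.
by rewrite eqxx.
Qed.

Lemma perm_mulmxE m (W : 'M[R]_(n, m)) i j : (perm_mx s *m W) i j = W (s i) j.
Proof. by rewrite -row_permE mxE. Qed.

Lemma orbit_mx_fixed : perm_mx s *m V = V.
Proof.
apply/matrixP=> i c; rewrite perm_mulmxE !VE !mem_orbit_block.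
suff -> : porbit s (s i) = porbit s i by [].
by apply/eqP; rewrite eq_porbit_mem -(expg1 s) mem_porbit.
Qed.

Lemma fixed_porbit m (W : 'M[R]_(n, m)) i j l :
  perm_mx s *m W = W -> j \in porbit s i -> W j l = W i l.
Proof.
move=> PW /porbitP[k ->]; elim: k => [|k IHk]; first by rewrite expg0 perm1.
by rewrite expgSr permM -IHk -[in RHS]PW perm_mulmxE.
Qed.

Lemma orbit_mx_proj_fixed m (W : 'M[R]_(n, m)) :
  perm_mx s *m W = W -> V *m (V^T *m W) = W.
Proof.
move=> PW; apply/matrixP=> i l; rewrite mxE.
have [c Ac] := orbit_blockP i.
have ic : i \in A c by rewrite mem_orbit_block Ac.
(* Row [i] of [V] vanishes outside the column [c] of the orbit of [i]. *)
rewrite (bigD1 c) //= [X in _ + X]big1 ?addr0; last first.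
  move=> d dc; rewrite VE mem_orbit_block -Ac.
  by rewrite (inj_eq A_inj) (negPf dc) mul0r.
rewrite mxE mulr_sumr VE ic.
(* The two weights multiply to [#|A c|%:R^-1], and [W] is constant on the orbit: what remains is a
   mean of [#|A c|] equal values. *)
under eq_bigr => j _.
  rewrite mxE VE.
  rewrite (_ : _ * _ = if j \in A c then #|A c|%:R^-1 * W i l else 0); first over.
  case: ifP => [jc|_]; last by rewrite mul0r mulr0.
  by rewrite mulrA orbit_weight_sqr (@fixed_porbit _ W i) // -Ac.
rewrite -big_mkcond /= sumr_const -[LHS]mulr_natl mulrA mulfV ?mul1r //.
by rewrite gt_eqF // orbit_block_gt0.
Qed.

Lemma orbit_mx_range :
  mx_range V = [set w : 'cV[R]_n | perm_mx s *m w = w]%classic.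
Proof.
apply/seteqP; split=> w /=; first by case=> x ->; rewrite mulmxA orbit_mx_fixed.
(* The witness consists of the coordinates of [w] along the orthonormal columns of [V]. *)
by move=> Pw; exists (V^T *m w); rewrite orbit_mx_proj_fixed.
Qed.

Lemma orbit_mx_sqrt_average K : (0 < K)%N -> perm_mx s ^+ K = 1%:M :> 'M[R]_n ->
  is_sqrt_mx V (mx_average (perm_mx s) K).
Proof.
move=> K_gt0 PK; rewrite /is_sqrt_mx; set Q := mx_average _ _.
have QV : Q *m V = V by apply: average_fixed => //; exact: orbit_mx_fixed.
have QP : Q *m perm_mx s = Q by exact: average_mulmx.
have PQt : perm_mx s *m Q^T = Q^T.
  (* The transpose of a permutation matrix is its inverse, so the two outer factors cancel. *)
  rewrite -{1}QP trmx_mul tr_perm_mx mulmxA.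
  by rewrite -perm_mxM mulgV perm_mx1 mul1mx.
apply: trmx_inj; rewrite trmx_mul trmxK.
by rewrite -(orbit_mx_proj_fixed PQt) -trmx_mul QV.
Qed.

End OrbitMatrix.

Theorem theorem5p1 (R : realType) (J D r K : nat)
    (P : 'M[R]_(J ^ D)) (s : 'S_(J ^ D)) (hP : P = perm_mx s)
    (C : 'I_r -> {set tindex J D}) (hC : lists_cycles s C)
    (hK : is_mx_order P K)
    (V : 'M[R]_(J ^ D, r)) (hV : is_cycle_mx C V) :
  [/\ mx_range V = [set w : 'cV[R]_(J ^ D) | P *m w = w]%classic,
      is_sqrt_mx V (mx_average P K)
    & V^T *m V = 1%:M].
Proof.
case: hC hK => C_inj C_porbits [K_gt0 PK _]; subst P.
have merge_inj : injective (@Defs.merge J D) := bij_inj (@merge_bij J D).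
(* The cycles, carried from tensor positions to row indices. *)
pose A c := [set Defs.merge j | j in C c]%SET.
have A_inj : injective A by move=> c d /(imset_inj merge_inj)/C_inj.
have VE i c : V i c = if i \in A c then 1 / Num.sqrt (#|A c|%:R) else 0.
  (* Surjectivity of [merge] writes any row [i] as a merged index; injectivity preserves membership
     and cycle lengths. *)
  have [g _ gK] := merge_bij J D; rewrite -(gK i) hV.
  by rewrite (mem_imset _ _ merge_inj) (card_imset _ merge_inj).
split.
- exact: (orbit_mx_range A_inj C_porbits VE).
- exact: (orbit_mx_sqrt_average A_inj C_porbits VE).
- exact: (orbit_mx_orthonormal A_inj C_porbits VE).
Qed.
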